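(* Let $\mathcal H$ be a separable Hilbert space and let $S:\mathcal H\to\mathcal H$ be a bounded, self-adjoint, positive definite operator (with bounded inverse $S^{-1}$). Let $S_1,S_2:\mathcal H\to\mathcal H$ be bounded, self-adjoint and positive semidefinite with $S=S_1+S_2$. Then the following are true: (1) For $i\in\{1,2\}$, $0\le S_iS^{-1}S_i$. (2) $S_2+S_1S^{-1}S_1\le S$. (3) $S_1S^{-1}S_1+S_2S^{-1}S_2\le S$. (4) $S_2+S_1S^{-1}S_1=S_1+S_2S^{-1}S_2$. (5) If $p,q\in\mathbb R$ are such that $\varrho(a):=a^2+a\,(q-p-1)+1-q\ge 0$ for all $a\in[0,1]$, then $p\,S_1+q\,S_2\le S_2+S_1S^{-1}S_1$. (6) If $p,q\in\mathbb R$ are such that $\eta(a):=a^2-a(1+p)+q+p\ge 0$ for all $a\in[0,1]$, then $S_1-S_1S^{-1}S_1\le p\,S_2+q\,S$. (7) If $p,q\in\mathbb R$ are such that $\tau(a):=a^2+a\left(\frac{q-p}{2}-1\right)+\frac{1-q}{2}\ge 0$ for all $a\in[0,1]$, then $p\,S_1+q\,S_2\le S_1S^{-1}S_1+S_2S^{-1}S_2$.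
   Context: For operators $U,V:\mathcal H\to\mathcal H$, write $U\le V$ if $U,V$ are self-adjoint and $V-U$ is positive semidefinite, i.e. $\langle (V-U)f,f\rangle\ge 0$ for all $f\in\mathcal H$. Positive definite operators are understood to be boundedly invertible. Hilbert spaces are complex. *)

(* Defs.v *)
From mathcomp Require Import all_boot all_order all_algebra.
From mathcomp Require Import complex.
From mathcomp Require Import all_classical all_reals all_analysis.

Set Implicit Arguments.
Unset Strict Implicit.
Unset Printing Implicit Defensive.

Import Order.TTheory GRing.Theory Num.Theory.
Import numFieldNormedType.Exports.

Local Open Scope classical_set_scope.
Local Open Scope ring_scope.

(* A complex Hilbert space is a complete normed module H over R[i] together
   with a positive definite Hermitian form dot (linear in its first argument)
   such that [norm_from_dot dot]. *)
Definition norm_from_dot (R : realType) (H : normedModType R[i])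
    (dot : {dot H for Num.conj}) : Prop :=
  forall f : H, `|f| ^+ 2 = dot f f.

Definition separable_space (T : topologicalType) : Prop :=
  exists2 D : set T, countable D & dense D.

Definition bounded_op (R : realType) (H : normedModType R[i])
    (U : H -> H) : Prop :=
  exists M : R, forall f : H, `|U f| <= (M%:C)%C * `|f|.

Definition self_adjoint (R : realType) (H : normedModType R[i])
    (dot : {dot H for Num.conj}) (U : H -> H) : Prop :=
  forall f g : H, dot (U f) g = dot f (U g).

(* In R[i], 0 <= z means that z is real and nonnegative. *)
Definition pos_semidef (R : realType) (H : normedModType R[i])
    (dot : {dot H for Num.conj}) (U : H -> H) : Prop :=
  forall f : H, 0 <= dot (U f) f.

(* Positive definite operators are boundedly invertible by convention, with
   inverse V. *)
Definition pos_def_with_inverse (R : realType) (H : normedModType R[i])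
    (dot : {dot H for Num.conj}) (U V : H -> H) : Prop :=
  [/\ forall f : H, f != 0 -> 0 < dot (U f) f,
      cancel U V, cancel V U & bounded_op V].

Definition op_le (R : realType) (H : normedModType R[i])
    (dot : {dot H for Num.conj}) (U V : H -> H) : Prop :=
  [/\ self_adjoint dot U, self_adjoint dot V & pos_semidef dot (V \- U)].

(* Main.v *)
Require Import Defs.
From mathcomp Require Import all_boot all_order all_algebra.
From mathcomp Require Import complex.
From mathcomp Require Import all_classical all_reals all_analysis.
From mathcomp Require Import ring lra.

Import Order.TTheory GRing.Theory Num.Theory.
Import numFieldNormedType.Exports.

Local Open Scope ring_scope.

(** All seven claims are statements about polynomials of the single operator
    [A = S^-1 S1].  For the inner product [<f, g>_S = <S f, g>] this [A] is
    self-adjoint with [0 <= A <= 1]; moreover [S1 = S A], [S2 = S (1 - A)],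
    [S1 S^-1 S1 = S A^2] and [S2 S^-1 S2 = S (1 - A)^2].  Each inequality
    asserts that [S P(A)] is positive semidefinite for some [P] of degree at
    most two that is nonnegative on [0, 1].

    No functional calculus is needed for such [P].  Fix [f] and consider the
    moments of order 0, 1, 2 of [A] at [f], the real numbers [s = <f, f>_S],
    [t = <A f, f>_S] and [u = <A^2 f, f>_S].  Then [0 <= t <= s], and [u <= t]
    because [A - A^2 = A (1 - A) A + (1 - A) A (1 - A)], so that [t - u] is the
    sum of [<S2 g, g>] at [g = A f] and [<S1 h, h>] at [h = f - A f].
    Furthermore [u - 2 r t + r^2 s = |A f - r f|_S^2 >= 0] for every real [r].
    These facts are [moments].  The quadratics in the last three claims have
    a positive leading coefficient, so they follow by Jensen's inequality: up to
    a positive factor the form is [u + b t + c s], and taking [r = t / s] bounds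
    it below by [s (r^2 + b r + c)], which is nonnegative as [0 <= r <= 1]
    ([monic_quadratic_ge0]).  The first claim says [u >= 0] and
    [s - 2 t + u >= 0], the second and third that [t - u >= 0], and the fourth
    is the identity [(1 - A) + A^2 = A + (1 - A)^2]. *)

(** Jensen's inequality for a monic quadratic, where [s], [t], [u] are the
    moments of order 0, 1, 2 of a measure of total mass [s] on [0, 1]. *)
Lemma monic_quadratic_ge0 {R : realFieldType} (b c s t u : R) :
  0 <= t <= s -> u <= t -> (forall r, 0 <= u - 2 * r * t + r ^+ 2 * s) ->
  (forall a, 0 <= a <= 1 -> 0 <= a ^+ 2 + b * a + c) ->
  0 <= u + b * t + c * s.
Proof.
move=> /andP[t0 ts] ut var P0.
have [s0|s0] := leP s 0.
  have u0 := var 0.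
  have -> : s = 0 by lra.
  have -> : t = 0 by lra.
  have -> : u = 0 by lra.
  lra.
pose r := t / s.
have tE : t = r * s by rewrite /r divfK // gt_eqF.
have r01 : 0 <= r <= 1.
  by rewrite divr_ge0 ?(ltW s0)//= ler_pdivrMr // mul1r.
have := mulr_ge0 (ltW s0) (P0 _ r01).
have := var r.
rewrite tE; nra.
Qed.

Section SelfAdjoint.
Context {R : realType} {H : normedModType R[i]} {dot : {dot H for Num.conj}}.
Implicit Types (U V : H -> H).

(** Rewriting with [linearDl] and its kin yields applications of [dot] through
    another structure, which hypotheses about [dot] no longer match; the
    following forms keep the head term unchanged. *)
Lemma dotDl (f g h : H) : dot (f + g) h = dot f h + dot g h.
Proof. exact: linearDl. Qed.

Lemma dotDr (f g h : H) : dot f (g + h) = dot f g + dot f h.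
Proof. exact: linearDr. Qed.

Lemma dotBl (f g h : H) : dot (f - g) h = dot f h - dot g h.
Proof. exact: linearBl. Qed.

Lemma dotBr (f g h : H) : dot f (g - h) = dot f g - dot f h.
Proof. exact: linearBr. Qed.

Lemma dotZl (k : R[i]) (f g : H) : dot (k *: f) g = k * dot f g.
Proof. exact: linearZl_LR. Qed.

Lemma dotZr_real (r : R) (f g : H) :
  dot f ((r%:C)%C *: g) = (r%:C)%C * dot f g.
Proof.
have /conj_Creal rC : (r%:C)%C \is Num.real by apply/complex_realP; exists r.
by rewrite -{2}rC; exact: linearZr_LR.
Qed.

Lemma self_adjoint0 : self_adjoint dot (\0 : H -> H).
Proof. by move=> f g; rewrite linear0l linear0r. Qed.

Lemma self_adjointD U V :
  self_adjoint dot U -> self_adjoint dot V -> self_adjoint dot (U \+ V).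
Proof. by move=> Usa Vsa f g; rewrite /= dotDl dotDr Usa Vsa. Qed.

Lemma self_adjointB U V :
  self_adjoint dot U -> self_adjoint dot V -> self_adjoint dot (U \- V).
Proof. by move=> Usa Vsa f g; rewrite /= dotBl dotBr Usa Vsa. Qed.

Lemma self_adjointZ (r : R) U :
  self_adjoint dot U -> self_adjoint dot ((r%:C)%C \*: U).
Proof. by move=> Usa f g; rewrite /= dotZl dotZr_real Usa. Qed.

Lemma self_adjoint_inverse U V :
  self_adjoint dot U -> cancel V U -> self_adjoint dot V.
Proof. by move=> Usa VK f g; rewrite -{1}(VK g) -Usa VK. Qed.

Lemma self_adjoint_sandwich U V :
  self_adjoint dot U -> self_adjoint dot V -> self_adjoint dot (U \o V \o U).
Proof. by move=> Usa Vsa f g; rewrite /= Usa Vsa Usa. Qed.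

Lemma pos_semidef_real U (f : H) : 0 <= dot (U f) f ->
  exists2 x : R, dot (U f) f = (x%:C)%C & 0 <= x.
Proof.
move=> U0; exists (complex.Re (dot (U f) f)).
  by rewrite RRe_real // ger0_real.
by rewrite -lecR RRe_real // ger0_real.
Qed.

End SelfAdjoint.

(** Replacing [S2] by [S - S1] gives
    [S2 S^-1 S2 = S - 2 S1 + S1 S^-1 S1]. *)
Lemma sandwich_swap {K : pzRingType} {H : lmodType K}
    (S Sinv S1 S2 : {linear H -> H}) :
  cancel S Sinv -> cancel Sinv S -> S = S1 \+ S2 :> (H -> H) ->
  S2 \+ (S1 \o Sinv \o S1) = S1 \+ (S2 \o Sinv \o S2).
Proof.
move=> SK SinvK S_sum; apply/funext => f /=.
have S2E g : S2 g = S g - S1 g by rewrite S_sum /= addrC addKr.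
rewrite !S2E !linearB /= SK SinvK.
by rewrite -opprD opprB addrCA subrKC.
Qed.

(** With [A = S^-1 S1], the numbers [s], [t], [u] are [<S f, f>], [<S A f, f>]
    and [<S A^2 f, f>]; through them, the forms at [f] of all the operators in
    play become real numbers subject to elementary inequalities.  Membership of the
    numbers in [R] is where positivity of the forms enters: in [R[i]] a
    nonnegative element is real. *)
Lemma moments {R : realType} {H : normedModType R[i]}
    {dot : {dot H for Num.conj}} {S Sinv S1 S2 : {linear H -> H}} :
  self_adjoint dot S -> pos_def_with_inverse dot S Sinv ->
  self_adjoint dot S1 -> pos_semidef dot S1 -> pos_semidef dot S2 ->
  S = S1 \+ S2 :> (H -> H) ->
  forall f, exists s t u : R,
  [/\ [/\ dot (S f) f = (s%:C)%C, dot (S1 f) f = (t%:C)%C,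
          dot (S2 f) f = ((s - t)%:C)%C,
          dot (S1 (Sinv (S1 f))) f = (u%:C)%C
        & dot (S2 (Sinv (S2 f))) f = ((s - 2 * t + u)%:C)%C],
      0 <= t <= s, u <= t &
      forall r, 0 <= u - 2 * r * t + r ^+ 2 * s].
Proof.
move=> S_sa [S_pos SK SinvK _] S1_sa S1_psd S2_psd S_sum f.
have S_psd g : 0 <= dot (S g) g.
  have [->|/S_pos/ltW//] := eqVneq g 0.
  by rewrite linear0r.
pose A g := Sinv (S1 g).
have SA g : S (A g) = S1 g by rewrite SinvK.
have S2E g : S2 g = S g - S1 g by rewrite S_sum /= addrC addKr.
have uE : dot (S1 (A f)) f = dot (S (A f)) (A f).
  by rewrite S1_sa -SA S_sa.
have [t tE t0] := pos_semidef_real _ _ (S1_psd f).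
have [d dE d0] := pos_semidef_real _ _ (S2_psd f).
have [u uC u0] := pos_semidef_real _ _ (S_psd (A f)).
have sE : dot (S f) f = ((t + d)%:C)%C.
  by rewrite S_sum /= dotDl tE dE rmorphD.
have mixed : dot (S f) (A f) = (t%:C)%C by rewrite S_sa SA -S1_sa.
exists (t + d), t, u; split=> //.
- split=> //; [by rewrite dE addrC addKr | by rewrite -/(A f) uE |].
  have swap := sandwich_swap S Sinv S1 S2 SK SinvK S_sum.
  have /(congr1 (dot^~ f)) : S2 f + S1 (A f) = S1 f + S2 (Sinv (S2 f)).
    exact: (congr1 (fun F : H -> H => F f) swap).
  rewrite !dotDl tE dE uE uC => /(canLR (addKr _)) <-.
  by rewrite -rmorphN -!rmorphD /=; congr (_%:C)%C; ring.
- by rewrite t0 lerDl.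
- (* This is A - A^2 = A (1 - A) A + (1 - A) A (1 - A) for the S-inner product. *)
  have := addr_ge0 (S2_psd (A f)) (S1_psd (f - A f)).
  have -> : dot (S2 (A f)) (A f) + dot (S1 (f - A f)) (f - A f)
      = ((t - u)%:C)%C.
    rewrite S2E (linearB S1) /= !dotBl !dotBr uE uC tE -(SA f) uC.
    by rewrite rmorphB /=; ring.
  by rewrite lecR subr_ge0.
- (* The squared S-norm of A f - r f. *)
  move=> r; have := S_psd (A f - (r%:C)%C *: f).
  suff -> : dot (S (A f - (r%:C)%C *: f)) (A f - (r%:C)%C *: f)
      = ((u - 2 * r * t + r ^+ 2 * (t + d))%:C)%C by rewrite lecR.
  rewrite (linearB S) (linearZ_LR S) /= !dotBl !dotBr !dotZl !dotZr_real.
  rewrite uC mixed SA tE sE.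
  by rewrite !(rmorphD, rmorphB, rmorphM, rmorphXn, rmorph_nat) /=; ring.
Qed.

Theorem theorem2p1 (R : realType) (H : completeNormedModType R[i])
    (dot : {dot H for Num.conj}) (Hdot : norm_from_dot dot)
    (Hsep : separable_space H)
    (S Sinv S1 S2 : {linear H -> H})
    (S_bounded : bounded_op S) (S_sa : self_adjoint dot S)
    (S_pd : pos_def_with_inverse dot S Sinv)
    (S1_bounded : bounded_op S1) (S1_sa : self_adjoint dot S1)
    (S1_psd : pos_semidef dot S1)
    (S2_bounded : bounded_op S2) (S2_sa : self_adjoint dot S2)
    (S2_psd : pos_semidef dot S2)
    (S_sum : S = S1 \+ S2 :> (H -> H)) :
  (op_le dot \0 (S1 \o Sinv \o S1) /\ op_le dot \0 (S2 \o Sinv \o S2))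
  /\ op_le dot (S2 \+ (S1 \o Sinv \o S1)) S
  /\ op_le dot ((S1 \o Sinv \o S1) \+ (S2 \o Sinv \o S2)) S
  /\ S2 \+ (S1 \o Sinv \o S1) = S1 \+ (S2 \o Sinv \o S2)
  /\ (forall p q : R,
        (forall a : R, 0 <= a <= 1 ->
           0 <= a ^+ 2 + a * (q - p - 1) + 1 - q) ->
        op_le dot (((p%:C)%C \*: S1) \+ ((q%:C)%C \*: S2))
                  (S2 \+ (S1 \o Sinv \o S1)))
  /\ (forall p q : R,
        (forall a : R, 0 <= a <= 1 ->
           0 <= a ^+ 2 - a * (1 + p) + q + p) ->
        op_le dot (S1 \- (S1 \o Sinv \o S1))
                  (((p%:C)%C \*: S2) \+ ((q%:C)%C \*: S)))
  /\ (forall p q : R,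
        (forall a : R, 0 <= a <= 1 ->
           0 <= a ^+ 2 + a * ((q - p) / 2 - 1) + (1 - q) / 2) ->
        op_le dot (((p%:C)%C \*: S1) \+ ((q%:C)%C \*: S2))
                  ((S1 \o Sinv \o S1) \+ (S2 \o Sinv \o S2))).
Proof.
have [_ SK SinvK _] := S_pd.
have Sinv_sa : self_adjoint dot Sinv by exact: self_adjoint_inverse S_sa SinvK.
have sa1 := self_adjoint_sandwich _ _ S1_sa Sinv_sa.
have sa2 := self_adjoint_sandwich _ _ S2_sa Sinv_sa.
have sa0 : self_adjoint dot (\0 : H -> H) := self_adjoint0.
have mom := moments S_sa S_pd S1_sa S1_psd S2_psd S_sum.
split; [split | split; [|split; [|split; [|split; [|split]]]]].
- split=> // f; have [s [t [u [[sE tE dE uE wE] /andP[t0 ts] ut var]]]] := mom f.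
  (* u = |A f|_S^2 *)
  by rewrite /= subr0 uE lecR; have := var 0; lra.
- split=> // f; have [s [t [u [[sE tE dE uE wE] /andP[t0 ts] ut var]]]] := mom f.
  (* s - 2 t + u = |A f - f|_S^2 *)
  by rewrite /= subr0 wE lecR; have := var 1; lra.
- split=> //; first exact: self_adjointD.
  move=> f; have [s [t [u [[sE tE dE uE wE] _ ut _]]]] := mom f.
  by rewrite /= dotBl dotDl sE dE uE -rmorphD -rmorphB lecR; lra.
- split=> //; first exact: self_adjointD.
  move=> f; have [s [t [u [[sE tE dE uE wE] _ ut _]]]] := mom f.
  by rewrite /= dotBl dotDl sE uE wE -rmorphD -rmorphB lecR; lra.
- exact: sandwich_swap.
- move=> p q P0; split.
  + by apply: self_adjointD; exact: self_adjointZ.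
  + exact: self_adjointD.
  move=> f; have [s [t [u [[sE tE dE uE wE] ts ut var]]]] := mom f.
  rewrite /= dotBl !dotDl !dotZl tE dE uE -!rmorphM -!rmorphD -rmorphB lecR.
  have := @monic_quadratic_ge0 _ (q - p - 1) (1 - q) s t u ts ut var.
  have P0' a : 0 <= a <= 1 -> 0 <= a ^+ 2 + (q - p - 1) * a + (1 - q).
    by move=> /P0; lra.
  by move=> /(_ P0'); lra.
- move=> p q P0; split.
  + exact: self_adjointB.
  + by apply: self_adjointD; exact: self_adjointZ.
  move=> f; have [s [t [u [[sE tE dE uE wE] ts ut var]]]] := mom f.
  rewrite /= !dotBl !dotDl !dotZl sE tE dE uE -!rmorphM -!rmorphD -!rmorphB lecR.
  have := @monic_quadratic_ge0 _ (- (1 + p)) (q + p) s t u ts ut var.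
  have P0' a : 0 <= a <= 1 -> 0 <= a ^+ 2 + - (1 + p) * a + (q + p).
    by move=> /P0; lra.
  by move=> /(_ P0'); lra.
- move=> p q P0; split.
  + by apply: self_adjointD; exact: self_adjointZ.
  + exact: self_adjointD.
  move=> f; have [s [t [u [[sE tE dE uE wE] ts ut var]]]] := mom f.
  rewrite /= dotBl !dotDl !dotZl tE dE uE wE -!rmorphM -!rmorphD -rmorphB lecR.
  (* The form is that of 2 A^2 + (q - p - 2) A + (1 - q), twice the quadratic
     of the hypothesis. *)
  have := @monic_quadratic_ge0 _ ((q - p) / 2 - 1) ((1 - q) / 2) s t u ts ut var.
  have P0' a : 0 <= a <= 1 -> 0 <= a ^+ 2 + ((q - p) / 2 - 1) * a + (1 - q) / 2.
    by move=> /P0; lra.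
  by move=> /(_ P0'); lra.
Qed.
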